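(* Let $n \geq 4$ and $k \geq 2$ be integers with $2^k - 1 < n < 2^{k+1} - 1$. Then there exists a total perfect dominating set $D$ of the hypercube $Q_n$ with $|D| = 2^{n-k}$ such that $Q_n - D$ is $(n-1)$-regular, $(n-1)$-connected and bipancyclic.
   Context: The hypercube $Q_n$ has vertex set $\{0,1\}^n$, two vertices being adjacent iff they differ in exactly one coordinate. For $D \subseteq V(Q_n)$, $Q_n - D$ is the subgraph induced on $V(Q_n)\setminus D$. A perfect dominating set of a graph is a set $D$ of vertices such that every vertex not in $D$ is adjacent to exactly one vertex of $D$; it is total if moreover every vertex of $D$ is adjacent to at least one vertex of $D$. A graph $G$ is bipancyclic if for every even integer $l$ with $4 \leq l \leq |V(G)|$, $G$ contains a cycle of length $l$. *)

(* Defs.v *)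
From HB Require Import structures.
From mathcomp Require Import all_boot.

Set Implicit Arguments.
Unset Strict Implicit.
Unset Printing Implicit Defensive.

Record sgraph := SGraph {
  vertex :> finType;
  adj : rel vertex;
  adj_sym : symmetric adj;
  adj_irrefl : irreflexive adj }.

Section Graphs.
Variable G : sgraph.

Definition nbhd (x : G) : {set G} := [set y | adj x y].

Section Induced.
Variable A : {set G}.

Definition induced_adj : rel {x : G | x \in A} :=
  fun x y => adj (val x) (val y).

Lemma induced_adj_sym : symmetric induced_adj.
Proof. by move=> x y; apply: adj_sym. Qed.

Lemma induced_adj_irrefl : irreflexive induced_adj.
Proof. by move=> x; apply: adj_irrefl. Qed.

Definition induced : sgraph := SGraph induced_adj_sym induced_adj_irrefl.

End Induced.

Definition delete (S : {set G}) : sgraph := induced (~: S).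

Definition regular (r : nat) : Prop := forall x : G, #|nbhd x| = r.

Definition perfect_dominating (D : {set G}) : Prop :=
  forall x : G, x \notin D -> #|nbhd x :&: D| = 1.

Definition total_perfect_dominating (D : {set G}) : Prop :=
  perfect_dominating D /\
  (forall x : G, x \in D -> exists2 y, y \in D & adj x y).

Definition connected_graph : Prop :=
  0 < #|G| /\ forall x y : G, connect (@adj G) x y.

(* [ucycle] accepts sequences of size 0 and 2, which are not graph cycles. *)
Definition is_cycle (c : seq G) : Prop := 2 < size c /\ ucycle (@adj G) c.

Definition bipancyclic : Prop :=
  forall l : nat, ~~ odd l -> 4 <= l <= #|G| ->
    exists2 c : seq G, is_cycle c & size c = l.

End Graphs.

Definition k_connected (r : nat) (G : sgraph) : Prop :=
  r < #|G| /\
  forall S : {set G}, #|S| < r -> connected_graph (delete S).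

Section Hypercube.
Variable n : nat.

Definition cube_adj : rel {ffun 'I_n -> bool} :=
  fun u v => #|[set i | u i != v i]| == 1.

Lemma cube_adj_sym : symmetric cube_adj.
Proof.
move=> u v; rewrite /cube_adj; congr (#|pred_of_set _| == 1).
by apply/setP=> i; rewrite !inE eq_sym.
Qed.

Lemma cube_adj_irrefl : irreflexive cube_adj.
Proof.
move=> u; apply/eqP=> /eqP/cards1P[i /setP/(_ i)].
by rewrite !inE !eqxx.
Qed.

Definition hypercube : sgraph := SGraph cube_adj_sym cube_adj_irrefl.

End Hypercube.

(* Main.v *)
(* Label the [n] directions by columns in F_2^k so that every nonzero column
   occurs exactly once (the zero column then occurs n - 2^k + 1 > 0 times), and
   let D be the kernel of the syndrome map.  A vertex with syndrome u <> 0 has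
   exactly one neighbour in D, across the direction of column u.
   Each direction with zero column makes the complement of D a product with an
   edge, which raises the connectivity by one; so connectivity reduces to the
   cube Q_t on the t = 2^k - 1 nonzero columns, minus a Hamming code.  There a
   path of Q_t avoiding the deleted vertices is rerouted around each codeword,
   whose neighbours are pairwise joined by t - 1 disjoint detours.
   The product of an edge and a graph with a Hamiltonian path contains a ladder,
   hence is bipancyclic; so it suffices to find a Hamiltonian path of Q_t minus
   the Hamming code, by induction on k.  Adding one dimension to F_2^k slices
   the new graph along a cube: even slices are translates of the old graph, odd
   slices are full cubes.  The slices are visited in the order of a Gray code,
   and each full cube is crossed by a Gray code of prescribed displacement. *)

Require Import Defs.
From mathcomp Require Import all_boot all_algebra.

Set Implicit Arguments.
Unset Strict Implicit.
Unset Printing Implicit Defensive.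

Import GRing.Theory.

(** * Addition in the elementary abelian 2-group of Boolean vectors *)

Section CubeGroup.
Local Open Scope ring_scope.
Variable J : finType.
Implicit Types x y z : {ffun J -> bool}.

Lemma cube_addvv x : x + x = 0.
Proof. by apply/ffunP=> i; rewrite !ffunE; case: (x i). Qed.

Lemma cube_addK y x : x + y + y = x.
Proof. by rewrite -addrA cube_addvv addr0. Qed.

Lemma cube_add_inj y : injective (fun x => x + y).
Proof. by move=> x z /(congr1 (+%R^~ y)); rewrite !cube_addK. Qed.

Lemma cube_add_eq x y z : (x + y == z) = (x == z + y).
Proof. by rewrite -{2}(cube_addK y x) (inj_eq (@cube_add_inj y)). Qed.

Lemma addvE x y j : (x + y) j = x j (+) y j.
Proof. by rewrite ffunE. Qed.

End CubeGroup.

(** * Walks, Hamiltonian paths and Gray codes in a cube *)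

Section Cube.
Local Open Scope ring_scope.
Variable I : finType.
Local Notation V := {ffun I -> bool}.
Implicit Types (x y z t : V) (i j : I) (w L : seq I).

Definition basis i : V := [ffun j => j == i].

Definition step : rel V := fun x y => [exists i, y == x + basis i].

Lemma basisE i j : basis i j = (j == i).
Proof. by rewrite ffunE. Qed.

Lemma basis_inj : injective basis.
Proof. by move=> i j /ffunP/(_ i); rewrite !basisE eqxx => /esym/eqP. Qed.

Lemma step_basis x i : step x (x + basis i).
Proof. by apply/existsP; exists i. Qed.

Lemma step_sym : symmetric step.
Proof.
by move=> x y; apply/existsP/existsP=> -[i /eqP->]; exists i; rewrite cube_addK.
Qed.

Lemma step_shift t x y : step (x + t) (y + t) = step x y.
Proof.
by apply: eq_existsb => i; rewrite addrAC (inj_eq (@cube_add_inj _ t)).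
Qed.

Definition supp (A : seq I) x := [forall i, x i ==> (i \in A)].

Lemma suppP (A : seq I) x : reflect (forall i, x i -> i \in A) (supp A x).
Proof. by apply: (iffP forallP) => H i; apply/implyP/H. Qed.

Lemma suppD (A : seq I) x y : supp A x -> supp A y -> supp A (x + y).
Proof.
move=> /suppP Hx /suppP Hy; apply/suppP=> i; rewrite addvE.
by case: (boolP (x i)) => [/Hx|_ /Hy].
Qed.

Lemma suppDr (A : seq I) x y : supp A y -> supp A (x + y) = supp A x.
Proof.
move=> Hy; apply/idP/idP=> Hx; last exact: suppD.
by rewrite -(cube_addK y x) suppD.
Qed.

Lemma supp_basis (A : seq I) i : supp A (basis i) = (i \in A).
Proof.
apply/suppP/idP=> [-> //|iA j]; rewrite ?basisE //.
by move/eqP->.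
Qed.

Lemma supp_sub (A B : seq I) x : {subset A <= B} -> supp A x -> supp B x.
Proof. by move=> sAB /suppP H; apply/suppP=> i /H /sAB. Qed.

Lemma eq_supp (A B : seq I) : A =i B -> supp A =1 supp B.
Proof. by move=> eqAB x; apply: eq_forallb => i; rewrite eqAB. Qed.

(** A path is coded by its start and the word of directions it crosses: translating it changes only
    the start, and reversing it reverses the word. *)
Fixpoint walk x w :=
  x :: if w is i :: w' then walk (x + basis i) w' else [::].

Definition disp w : V := \sum_(i <- w) basis i.

Lemma disp_cons i w : disp (i :: w) = basis i + disp w.
Proof. by rewrite /disp big_cons. Qed.

Lemma disp_cat w1 w2 : disp (w1 ++ w2) = disp w1 + disp w2.
Proof. by rewrite /disp big_cat. Qed.

Lemma disp_rev w : disp (rev w) = disp w.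
Proof. exact/perm_big/permEl/perm_rev. Qed.

Lemma size_walk x w : size (walk x w) = (size w).+1.
Proof. by elim: w x => //= i w IH x; rewrite IH. Qed.

Lemma walk_start x w : x \in walk x w.
Proof. by case: w => [|i w] /=; rewrite mem_head. Qed.

(** The letter [i] is the edge between the two pieces, so their vertex lists are concatenated
    without a repeated junction. *)
Lemma walk_cat x w1 i w2 :
  walk x (w1 ++ i :: w2) = walk x w1 ++ walk (x + disp w1 + basis i) w2.
Proof.
elim: w1 x => [|j w1 IH] x /=; first by rewrite /disp big_nil addr0.
by rewrite IH disp_cons !addrA.
Qed.

Lemma walk_rev x w : walk (x + disp w) (rev w) = rev (walk x w).
Proof.
elim: w x => [|i w IH] x /=; first by rewrite /disp big_nil addr0.
rewrite rev_cons -cats1 walk_cat disp_cons addrA IH /= rev_cons -cats1.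
by rewrite disp_rev !cube_addK.
Qed.

Lemma walk_shift t x w : walk (x + t) w = [seq z + t | z <- walk x w].
Proof. by elim: w x => //= i w IH x; rewrite -IH addrAC. Qed.

Lemma mem_walk_shift t x w z : (z \in walk (x + t) w) = (z + t \in walk x w).
Proof.
by rewrite walk_shift -{1}(cube_addK t z) (mem_map (@cube_add_inj _ t)).
Qed.

Lemma uniq_walk_shift t x w : uniq (walk (x + t) w) = uniq (walk x w).
Proof. by rewrite walk_shift map_inj_uniq //; apply: cube_add_inj. Qed.

Lemma take_walk r x w :
  (r <= size w)%N -> take r.+1 (walk x w) = walk x (take r w).
Proof.
elim: w r x => [|i w IH] [|r] x //= Hr; first by case: w {IH Hr}.
by rewrite -IH.
Qed.

Lemma path_walk x w : path step x (behead (walk x w)).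
Proof.
elim: w x => //= i w IH x; have:= IH (x + basis i).
by case: w {IH} => [|j w] /=; rewrite step_basis.
Qed.

Lemma last_walk x w y : last y (walk x w) = x + disp w.
Proof.
elim: w x y => [|i w IH] x y /=; first by rewrite /disp big_nil addr0.
by rewrite IH disp_cons addrA.
Qed.

Lemma walkE x w : walk x w = x :: behead (walk x w).
Proof. by case: w. Qed.

Lemma walk_end x w : x + disp w \in walk x w.
Proof. by rewrite -(last_walk x w x) walkE /= mem_last. Qed.

Definition ham (X : pred V) x w := uniq (walk x w) /\ walk x w =i X.

Lemma eq_ham (X Y : pred V) x w : X =1 Y -> ham X x w -> ham Y x w.
Proof. by move=> eqXY [u m]; split=> // z; rewrite m; apply: eqXY. Qed.

Lemma ham_shift (X : pred V) x w t :
  ham X x w -> ham (fun z => X (z + t)) (x + t) w.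
Proof.
by move=> [u m]; split=> [|z]; rewrite ?uniq_walk_shift // mem_walk_shift m.
Qed.

Lemma ham_rev (X : pred V) x w : ham X x w -> ham X (x + disp w) (rev w).
Proof.
by move=> [u m]; split=> [|z]; rewrite walk_rev ?rev_uniq // mem_rev m.
Qed.

Lemma ham_cat (X Y : pred V) x w1 i w2 :
    ham X x w1 -> ham Y (x + disp w1 + basis i) w2 ->
    (forall z, X z -> ~~ Y z) ->
  ham (predU X Y) x (w1 ++ i :: w2).
Proof.
move=> [u1 m1] [u2 m2] dXY; split=> [|z]; rewrite walk_cat.
  rewrite cat_uniq u1 u2 andbT /=; apply/hasPn=> z; rewrite m2 m1 => Yz.
  by apply/negP=> /dXY /negP.
by rewrite mem_cat m1 m2.
Qed.

(** The translate is traversed backwards, so that it is entered just across [i] from the end of the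
    first copy. *)
Lemma ham_double (X : pred V) x w i :
    ham X x w -> (forall z, X z -> ~~ X (z + basis i)) ->
  ham (predU X (fun z => X (z + basis i))) x (w ++ i :: rev w).
Proof. by move=> h d; apply: ham_cat => //; apply/ham_shift/ham_rev. Qed.

Lemma supp_cons i L z : supp (i :: L) z = supp L z || supp L (z + basis i).
Proof.
have sL : {subset L <= i :: L} by move=> j jL; rewrite inE jL orbT.
apply/idP/orP => [/suppP H|[|]]; last 2 first.
- exact: supp_sub.
- by move/(supp_sub sL); rewrite suppDr // supp_basis mem_head.
case: (boolP (z i)) => zi; [right|left]; apply/suppP=> j.
  rewrite addvE basisE; case: (eqVneq j i) => [->|ji]; first by rewrite zi.
  by rewrite addbF => /H; rewrite inE (negPf ji).
by move=> zj; have:= H j zj; rewrite inE; case: eqP zi => // <-; rewrite zj.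
Qed.

Lemma supp_basisN L i z : i \notin L -> supp L z -> ~~ supp L (z + basis i).
Proof.
move=> iL /suppP H; apply/suppP=> /(_ i); rewrite addvE basisE eqxx.
by have:= H i; case: (z i) => [/(_ isT)|_ /(_ isT)] iL'; rewrite iL' in iL.
Qed.

Lemma ham_supp_cons (P : pred V) L x w i :
    i \notin L -> (forall z, P (z + basis i) = P z) ->
    ham (fun z => supp L z && P z) x w ->
  ham (fun z => supp (i :: L) z && P z) x (w ++ i :: rev w).
Proof.
move=> iL Pi h; apply: eq_ham (ham_double h _) => [z|z /andP[sz _]] /=.
  by rewrite Pi supp_cons; case: (P z); rewrite ?andbT ?andbF.
by rewrite (negPf (supp_basisN iL sz)).
Qed.

Lemma ham_supp_cat (P : pred V) (K L : seq I) x w :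
    uniq (K ++ L) -> (forall i z, i \in K -> P (z + basis i) = P z) ->
    ham (fun z => supp L z && P z) x w ->
  exists w', ham (fun z => supp (K ++ L) z && P z) x w'.
Proof.
move=> + + h; elim: K => [|i K IH] /=; first by exists w.
move=> /andP[iKL uKL] Pi; have [//|j z jK|w' h'] := IH.
  by rewrite Pi // inE jK orbT.
exists (w' ++ i :: rev w'); apply: ham_supp_cons h' => // z.
by rewrite Pi ?mem_head.
Qed.

Fixpoint gray L := if L is i :: L' then gray L' ++ i :: rev (gray L') else [::].

(** The two copies of the inner word cancel. Hence any letter can be made the displacement of a Gray
    code by listing it first. *)
Lemma disp_gray i L : disp (gray (i :: L)) = basis i.
Proof. by rewrite /= disp_cat disp_cons disp_rev addrCA cube_addvv addr0. Qed.

Lemma odd_gray i L : odd (size (gray (i :: L))).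
Proof. by rewrite /= size_cat /= size_rev addnS /= addnn odd_double. Qed.

Lemma ham_gray L x : uniq L -> ham (fun z => supp L (z + x)) x (gray L).
Proof.
move=> uL; suff h: ham (supp L) 0 (gray L).
  by have:= ham_shift x h; rewrite add0r.
elim: L uL => [_|i L IH /= /andP[iL /IH h]].
  split=> // z; rewrite inE -topredE /=; apply/eqP/suppP=> [-> i|H].
    by rewrite ffunE.
  by apply/ffunP=> i; rewrite [RHS]ffunE; apply/negbTE/negP=> /H.
apply: eq_ham (@ham_supp_cons predT L 0 _ i iL _ (eq_ham _ h)) => // z;
  by rewrite andbT.
Qed.

Lemma mem_gray L i : (i \in gray L) -> i \in L.
Proof.
elim: L => //= j L IH; rewrite mem_cat !inE mem_rev orbCA orbb.
by case/orP=> [->//|/IH->]; rewrite orbT.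
Qed.

(* The walk and its translate form a ladder; its first [r.+1] rungs span a
   cycle. *)
Lemma ladder_cycle (X : pred V) x w i r :
    ham X x w -> (forall z, X z -> ~~ X (z + basis i)) -> (r <= size w)%N ->
  let c := walk x (take r w ++ i :: rev (take r w)) in
  [/\ ucycle step c, size c = r.+1.*2 &
      forall z, z \in c -> X z || X (z + basis i)].
Proof.
move=> [u m] d rw; set w' := take r w.
have h : ham (fun z => z \in walk x w') x w'.
  by split=> //; rewrite -take_walk // take_uniq.
have sub z : z \in walk x w' -> X z.
  by rewrite -take_walk // => /mem_take; rewrite m.
have dd z : z \in walk x w' -> ~~ (z + basis i \in walk x w').
  by move=> /sub /d; apply: contra => /sub.
have [u' m'] := ham_double h dd; split.
- rewrite /ucycle u' andbT walkE /= rcons_path path_walk.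
  (* The closing edge: the two copies of [w'] cancel, so the walk ends at [x + basis i]. *)
  rewrite -[X in step X _](last_cons x) -walkE last_walk disp_cat disp_cons.
  by rewrite disp_rev [disp w' + _]addrCA cube_addvv addr0 step_sym step_basis.
- rewrite size_walk size_cat /= size_rev size_takel //.
  by rewrite addnS doubleS addnn.
by move=> z; rewrite m' => /orP[]/sub->; rewrite ?orbT.
Qed.

End Cube.

(** * A Hamiltonian path in the complement of a Hamming code *)

Section Hamming.
Local Open Scope ring_scope.
Variables (I : finType) (k : nat).
Local Notation V := {ffun I -> bool}.
Local Notation W := {ffun 'I_k -> bool}.
Variable phi : I -> W.
Hypothesis phi_onto : forall u, exists i, phi i = u.
Hypothesis phi_inj : forall i j, phi i != 0 -> phi i = phi j -> i = j.
Implicit Types (x y z v : V) (i b : I) (w L : seq I) (u : W) (a : 'I_k).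

Definition syn z : W := \sum_i phi i *+ z i.

Lemma synD x y : syn (x + y) = syn x + syn y.
Proof.
rewrite /syn -big_split; apply: eq_bigr => i _; rewrite addvE.
by case: (x i) (y i) => -[] /=;
  rewrite ?mulr0n ?mulr1n ?addr0 ?add0r ?cube_addvv.
Qed.

Lemma syn_basis i : syn (basis i) = phi i.
Proof.
rewrite /syn (bigD1 i) //= basisE eqxx mulr1n big1 ?addr0 // => j ji.
by rewrite basisE (negPf ji).
Qed.

Lemma synE z a : syn z a = \sum_i (z i && phi i a).
Proof.
rewrite /syn sum_ffunE; apply: eq_bigr => i _.
by case: (z i); rewrite ?mulr1n // mulr0n ffunE.
Qed.

Lemma syn0 : syn 0 = 0.
Proof. by rewrite /syn big1 // => i _; rewrite ffunE. Qed.

Definition low (m : nat) u := [forall a : 'I_k, (m <= a)%N ==> ~~ u a].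

Lemma lowP m u : reflect (forall a : 'I_k, (m <= a)%N -> u a = false) (low m u).
Proof.
apply: (iffP forallP) => H a; last by apply/implyP=> /H->.
by move=> ma; apply: negbTE; exact: (implyP (H a)).
Qed.

Definition letters m := [seq i <- enum I | (phi i != 0) && low m (phi i)].

Lemma mem_letters m i : (i \in letters m) = (phi i != 0) && low m (phi i).
Proof. by rewrite mem_filter mem_enum andbT. Qed.

(** The complement of the Hamming code of length 2^m - 1, inside the fixed ambient cube: the
    induction runs over [m] with [k] and [phi] unchanged. *)
Definition live m z := supp (letters m) z && (syn z != 0).

(** * The induction step: slicing along the new coordinate [a] *)

Section Step.
Variable a : 'I_k.
Local Notation X := (live a.+1).
Local Notation A := (letters a).

Definition top := [seq i <- enum I | low a.+1 (phi i) && phi i a].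

Lemma mem_top i : (i \in top) = low a.+1 (phi i) && phi i a.
Proof. by rewrite mem_filter mem_enum andbT. Qed.

Lemma lowS u : low a u = low a.+1 u && ~~ u a.
Proof.
apply/lowP/andP=> [H|[/lowP H ua] c].
  by rewrite H //; split=> //; apply/lowP=> c /ltnW /H.
rewrite leq_eqVlt => /orP[/eqP/val_inj<-|/H//]; exact: negbTE.
Qed.

Lemma mem_lettersS i : (i \in letters a.+1) = (i \in A) || (i \in top).
Proof.
rewrite !mem_letters mem_top lowS; case: (low _ _); rewrite ?andbF //= !andbT.
case: (boolP (phi i a)) => //= ia; rewrite ?andbF ?andbT ?orbF //=.
by apply/eqP=> i0; rewrite i0 ffunE in ia.
Qed.

(** On vectors supported in [letters a.+1] this is the restriction to [top]; its value labels the
    slice containing [z]. *)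
Definition res z : V := [ffun i => z i && phi i a].

Lemma resD x y : res (x + y) = res x + res y.
Proof.
apply/ffunP=> i; rewrite !(ffunE, addvE).
by case: (phi i a); rewrite ?andbT ?andbF.
Qed.

Lemma res_basis i : phi i a -> res (basis i) = basis i.
Proof.
move=> ia; apply/ffunP=> j; rewrite !ffunE.
by case: eqP => // ->.
Qed.

Lemma res_low z : supp A z -> res z = 0.
Proof.
move=> /suppP H; apply/ffunP=> i; rewrite ffunE [RHS]ffunE.
apply/negbTE/negP=> /andP[/H]; rewrite mem_letters lowS.
by move=> /andP[_ /andP[_ /negPf->]].
Qed.

Lemma supp_low z : supp A z = supp (letters a.+1) z && (res z == 0).
Proof.
apply/idP/andP=> [H|[/suppP H /eqP/ffunP rz]].
  rewrite res_low //; split=> //; apply: supp_sub H => i iA.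
  by rewrite mem_lettersS iA.
apply/suppP=> i zi; have:= H i zi; rewrite mem_lettersS => /orP[] //.
by rewrite mem_top => /andP[_ ia]; have:= rz i; rewrite !ffunE zi ia.
Qed.

Lemma supp_top z : supp (letters a.+1) z -> supp top (res z).
Proof.
move=> /suppP H; apply/suppP=> i; rewrite ffunE => /andP[/H].
rewrite mem_lettersS => /orP[] //.
by rewrite mem_letters lowS => /andP[_ /andP[_ /negPf->]].
Qed.

Lemma syn_res z : syn (res z) a = syn z a.
Proof. by rewrite !synE; apply: eq_bigr => i _; rewrite ffunE -andbA andbb. Qed.

(** Coordinate [a] of the syndrome depends only on the slice label. If it is 1, the slice contains
    no codeword and is a whole translate of the cube on [A]. *)
Lemma full_slice x z : supp (letters a.+1) x -> syn (res x) a ->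
  supp A (z + x) = X z && (res z == res x).
Proof.
move=> sx ox; rewrite supp_low suppDr // resD cube_add_eq add0r /live.
case: (supp _ z) => //=; case: eqP => [rz|_]; rewrite ?andbF // andbT.
by symmetry; apply/eqP=> s0; rewrite -rz syn_res s0 ffunE in ox.
Qed.

(* Slices of constant restriction [v] to [top] alternate, along [walk v beta],
   between a translate of the smaller complement and a full subcube; each full
   subcube is crossed by a Gray code whose displacement is the letter
   [phi b1 + phi b2], so that the next complement is entered where the
   previous one was left and is traversed backwards. *)
Lemma ham_slices beta v x w :
    odd (size beta) -> uniq (walk v beta) -> {subset beta <= top} ->
    syn v a = false -> ham (fun z => X z && (res z == v)) x w ->
  exists w', ham (fun z => X z && (res z \in walk v beta)) x w'.
Proof.
(* Each round consumes two letters of [beta], hence the induction on a bound for its length. *)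
have [n] := ubnP (size beta); elim: n beta v x w => // n IH.
have topa i : i \in top -> phi i a by rewrite mem_top => /andP[].
have topS i : i \in top -> i \in letters a.+1.
  by rewrite mem_lettersS => ->; rewrite orbT.
move=> [|b1 beta] // v x w szb ob ub btop sv h.
have b1t : b1 \in top by apply: btop; rewrite mem_head.
set x1 := x + disp w; have := walk_end x w.
rewrite -/x1 (proj2 h) => /andP[/andP[sx1 nx1] /eqP rx1].
set x2 := x1 + basis b1.
have rx2 : res x2 = v + basis b1 by rewrite resD rx1 res_basis // topa.
have sx2 : supp (letters a.+1) x2 by rewrite suppD // supp_basis topS.
have ox2 : syn (res x2) a by rewrite rx2 synD addvE sv syn_basis topa.
have full z := full_slice z sx2 ox2.
have vb1 : v != v + basis b1.
  by apply/eqP=> vE; move: ub; rewrite /= {1}vE walk_start.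
case: beta szb ob ub btop => [|b2 beta] szb ob ub btop.
  (* The last slice is full, since [beta] has odd length, and its exit point is free: any Gray code
     will do. *)
  exists (w ++ b1 :: gray A).
  apply: eq_ham (ham_cat h (ham_gray _ _) _) => [z||z /andP[_ /eqP rz]].
  - by rewrite /= full rx2 !inE; case: (X z).
  - exact/filter_uniq/enum_uniq.
  - by rewrite full rz rx2 (negPf vb1) andbF.
have b2t : b2 \in top by apply: btop; rewrite !inE eqxx orbT.
have b12 : b1 != b2.
  apply/eqP=> b12; move: ub; rewrite /= b12 cube_addK inE => /andP[/negP[]].
  by rewrite walk_start orbT.
(* The letter [j] is low because coordinate [a] cancels in the sum, and its column is nonzero
   because [b1] and [b2] have distinct columns. *)
have [j pj] := phi_onto (phi b1 + phi b2).
have jA : j \in A.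
  rewrite mem_letters lowS pj addvE !topa //= andbT cube_add_eq add0r.
  apply/andP; split.
    apply/eqP=> /phi_inj b12E; move/eqP: b12; apply; apply: b12E.
    by apply/eqP=> /ffunP/(_ a); rewrite topa // ffunE.
  apply/lowP=> c ac; rewrite addvE.
  move: b1t b2t; rewrite !mem_top => /andP[/lowP H1 _] /andP[/lowP H2 _].
  by rewrite H1 ?H2.
set g := gray (j :: rem j A); set v2 := v + basis b1 + basis b2.
have uA : uniq A by exact/filter_uniq/enum_uniq.
have hg : ham (fun z => X z && (res z == v + basis b1)) x2 g.
  apply: eq_ham (@ham_gray _ (j :: rem j A) x2 _) => [z|].
    by rewrite -rx2 -full; apply/eq_supp/perm_mem; rewrite perm_sym perm_to_rem.
  by rewrite -(perm_uniq (perm_to_rem jA)).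
set x4 := x2 + disp g + basis b2.
have sj : supp (letters a.+1) (basis j) by rewrite supp_basis mem_lettersS jA.
(* From [x1] to [x4] the translation is by a vector with columns [phi b1], [phi j], [phi b2], whose
   sum is zero. It preserves syndromes, so it carries the reversed path of slice [v] to one of slice
   [v2]. *)
have h4 : ham (fun z => X z && (res z == v2)) x4 (rev w).
  have -> : x4 = x1 + (basis b1 + basis j + basis b2).
    by rewrite /x4 disp_gray !addrA.
  apply: eq_ham (ham_shift _ (ham_rev h)) => z.
  congr (_ && _).
    rewrite /live suppDr; last by rewrite !suppD // supp_basis topS.
    congr (_ && (_ != 0)).
    rewrite !synD !syn_basis pj [phi b1 + _]addrA cube_addvv add0r cube_addvv.
    by rewrite addr0.
  rewrite !resD (res_basis (topa _ b1t)) (res_basis (topa _ b2t)).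
  rewrite (@res_low (basis j)) ?supp_basis // addr0.
  by rewrite cube_add_eq addrA.
move: ub; rewrite /= -/v2 inE negb_or => /and3P[/andP[_ vn] v1n ub].
have sv2 : syn v2 a = false.
  by rewrite !synD !addvE sv !syn_basis !topa.
have [||i ib|w' h'] // := IH beta v2 x4 (rev w) _ _ ub _ sv2 h4.
- by move: szb; rewrite /= !ltnS => /ltnW.
- by move: ob; rewrite /= negbK.
- by apply: btop; rewrite !inE ib !orbT.
exists (w ++ b1 :: (g ++ b2 :: w')).
apply: eq_ham (ham_cat h (ham_cat hg h' _) _) => [z|z|z] /=.
- by rewrite !inE; case: (X z).
- by move=> /andP[_ /eqP->]; rewrite (negPf v1n) andbF.
- move=> /andP[_ /eqP->]; rewrite (negPf vn) andbF orbF.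
  by rewrite (negPf vb1) andbF.
Qed.

End Step.

Lemma exists_ham_live m : (0 < m <= k)%N -> exists x w, ham (live m) x w.
Proof.
elim: m => // m IH /andP[_ mk]; pose a := Ordinal mk.
(* The unit column at [a] shows that [top a] is nonempty. *)
have [d dE] : exists d, phi d = basis a by exact: phi_onto.
have dt : d \in top a.
  rewrite mem_top dE basisE eqxx andbT; apply/lowP=> c ac.
  by rewrite basisE; apply: contraTF ac => /eqP->; rewrite ltnn.
(* For [m = 0] the only letter is [d], and [basis d] is the only live vertex: the path is a single
   point. *)
have [m0|m_gt0] := posnP m.
  exists (basis d), [::]; split=> // z; rewrite inE -topredE /= /live.
  have d0 : phi d != 0.
    by rewrite dE; apply/eqP=> /ffunP/(_ a); rewrite basisE eqxx ffunE.
  apply/eqP/andP=> [->|[/suppP sz nz]].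
    rewrite supp_basis syn_basis d0; split=> //.
    by rewrite (@mem_lettersS a) dt orbT.
  have uz i : z i -> i = d.
    move=> /sz; rewrite mem_letters => /andP[i0 /lowP il]; apply: phi_inj => //.
    rewrite dE; have i1 c : c != a -> phi i c = false.
      move=> ca; apply: il; rewrite ltn_neqAle m0 andbT.
      by apply: contraNneq ca => ca; apply/eqP/val_inj; rewrite /= m0 ca.
    apply/ffunP=> c; rewrite basisE; case: eqP => [->|/eqP/i1//].
    apply: contraNT i0 => ia; apply/eqP/ffunP=> e; rewrite [RHS]ffunE.
    by case: (eqVneq e a) => [->|/i1//]; apply: negbTE.
  apply/ffunP=> i; rewrite basisE; apply/idP/eqP=> [/uz//|->].
  apply: contraNT nz => zd; apply/eqP; rewrite -syn0; congr syn.
  apply/ffunP=> c; rewrite [RHS]ffunE; apply/negbTE/negP=> zc.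
  by rewrite -(uz c zc) zc in zd.
have [|x [w h]] := IH; first by rewrite m_gt0 ltnW.
have ut : uniq (top a) by exact/filter_uniq/enum_uniq.
have [ug mg] := ham_gray 0 ut.
(* The slice labelled 0 is the smaller complement, where the tour of the slices starts. *)
have h0 : ham (fun z => live a.+1 z && (res a z == 0)) x w.
  apply: eq_ham h => z; rewrite /live -[letters m]/(letters a) supp_low.
  by rewrite andbAC.
have og : odd (size (gray (top a))).
  by case: (top a) dt => // i L _; apply: odd_gray.
have s0 : syn 0 a = false by rewrite syn0 ffunE.
have gt i : i \in gray (top a) -> i \in top a := @mem_gray _ _ i.
have [w' h'] := ham_slices og ug gt s0 h0.
exists x, w'; apply: eq_ham h' => z; rewrite mg unfold_in addr0 andb_idr //.
by case/andP=> /supp_top.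
Qed.

End Hamming.

(** * Connectivity of induced subgraphs and products with an edge *)

Section Connectivity.
Local Open Scope ring_scope.
Variable I : finType.
Local Notation V := {ffun I -> bool}.
Implicit Types (x y z c u v : V) (i j l : I) (L K : seq I) (X Y S B : {set V}).

Definition within B : rel V := fun x y => [&& x \in B, y \in B & step x y].

(** Connectivity of the subgraph induced on [X], phrased on the ambient vertices so that no nested
    subtypes arise; [kconn_k_connected] transfers it to [delete]. *)
Definition kconn (r : nat) X :=
  (r < #|X|)%N /\ forall S, (#|S| < r)%N ->
    {in X :\: S &, forall x y, connect (within (X :\: S)) x y}.

Lemma connect_homo (T T' : finType) (f : T -> T') (e : rel T) (e' : rel T')
    (x y : T) :
    (forall a b, e a b -> e' (f a) (f b)) ->
  connect e x y -> connect e' (f x) (f y).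
Proof.
move=> fe /connectP[p pP ->{y}]; apply/connectP; exists (map f p).
  rewrite path_map; exact: sub_path pP.
by rewrite last_map.
Qed.

Lemma within_sub B B' x y :
  B \subset B' -> connect (within B) x y -> connect (within B') x y.
Proof.
move=> /subsetP sB; apply: (@connect_homo _ _ id) => a b /and3P[aB bB ab].
by rewrite /within !sB.
Qed.

Lemma within_sym B : symmetric (within B).
Proof. by move=> x y; rewrite /within step_sym andbCA. Qed.

Lemma connect_withinC B x y : connect (within B) x y = connect (within B) y x.
Proof. exact/sym_connect_sym/within_sym. Qed.

Lemma within_basis B x i :
  x \in B -> x + basis i \in B -> connect (within B) x (x + basis i).
Proof. by move=> xB yB; apply: connect1; rewrite /within xB yB step_basis. Qed.

Definition shift i X : {set V} := [set z : V | z + basis i \in X].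

Lemma mem_shift i X z : (z \in shift i X) = (z + basis i \in X).
Proof. by rewrite inE. Qed.

Lemma shiftK i X : shift i (shift i X) = X.
Proof. by apply/setP=> z; rewrite !mem_shift cube_addK. Qed.

Lemma card_shift i X : #|shift i X| = #|X|.
Proof.
have -> : shift i X = (fun z => z + basis i) @: X.
  apply/setP=> z; rewrite mem_shift.
  apply/idP/imsetP=> [zX|[y yX ->]]; last by rewrite cube_addK.
  by exists (z + basis i); rewrite ?cube_addK.
by rewrite card_imset //; apply: cube_add_inj.
Qed.

Lemma kconn_shift r i X : kconn r X -> kconn r (shift i X).
Proof.
move=> [rX cX]; split=> [|S Sr x y xX yX]; first by rewrite card_shift.
rewrite -(cube_addK (basis i) x) -(cube_addK (basis i) y).
apply: (@connect_homo _ _ (fun z => z + basis i) (within (X :\: shift i S))).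
  by move=> a b; rewrite /within !in_setD !mem_shift !cube_addK step_shift.
by apply: cX; rewrite ?card_shift //; move: xX yX;
  rewrite !in_setD !mem_shift ?cube_addK.
Qed.

(** If [S] has fewer than [r] vertices in [X], connect inside [X]. Otherwise [S] lies wholly in [X]
    and the other copy is intact: cross from [u], travel there, and return along the spared rung at
    [z]. *)
Lemma kconn_half r i X S z :
    (0 < r)%N -> kconn r X -> [disjoint X & shift i X] -> (#|S| <= r)%N ->
    z \in X -> z \notin S -> z + basis i \notin S ->
  {in X :\: S, forall u,
     connect (within ((X :|: shift i X) :\: S)) u z}.
Proof.
move=> r0 kX dX Sr zX zS ziS u; rewrite in_setD => /andP[uS uX].
have [lt|ge] := ltnP #|S :&: X| r.
  apply: within_sub (proj2 kX _ lt u z _ _); last 2 first.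
  - by rewrite !inE uX (negPf uS).
  - by rewrite !inE zX (negPf zS).
  by apply/subsetP=> a; rewrite !inE negb_and => /andP[/orP[->|/negP//] ->].
have S1 : S :&: shift i X = set0.
  apply/eqP; rewrite -cards_eq0 -leqn0 -(leq_add2l #|S :&: X|) addn0.
  rewrite -cardsUI -setIUr setIACA setIid (disjoint_setI0 dX) setI0 cards0.
  rewrite addn0.
  exact: leq_trans (leq_trans (subset_leq_card (subsetIl _ _)) Sr) ge.
have nS a : a \in X -> a + basis i \notin S.
  move=> aX; apply/negP=> aS; have: a + basis i \in S :&: shift i X.
    by rewrite inE aS mem_shift cube_addK.
  by rewrite S1 inE.
apply: (@connect_trans _ _ (u + basis i)).
  by apply: within_basis; rewrite !inE ?uS ?uX ?nS ?cube_addK ?uX ?orbT.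
apply: (@connect_trans _ _ (z + basis i)); last first.
  rewrite connect_withinC; apply: within_basis;
  by rewrite !inE ?zS ?zX ?nS ?cube_addK ?zX ?orbT.
have [_ cX] := kconn_shift i kX.
apply: within_sub (cX set0 _ (u + basis i) (z + basis i) _ _).
- apply/subsetP=> a; rewrite !inE /= => aX; rewrite aX orbT andbT.
  by rewrite -(cube_addK (basis i) a) nS.
- by rewrite cards0.
- by rewrite !inE cube_addK.
- by rewrite !inE cube_addK.
Qed.

(** A deleted vertex spoils only one rung and there are more than [r] rungs, so some rung survives;
    both halves connect to it by [kconn_half]. *)
Lemma kconn_double r i X :
    (0 < r)%N -> kconn r X -> [disjoint X & shift i X] ->
  kconn r.+1 (X :|: shift i X).
Proof.
move=> r0 kX dX; have [rX cX] := kX.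
split=> [|S Sr].
  rewrite cardsU (disjoint_setI0 dX) cards0 subn0 card_shift.
  by rewrite -addn1 leq_add // (leq_trans r0) // ltnW.
rewrite ltnS in Sr.
have [z zX zS] : exists2 z, z \in X & (z \notin S) && (z + basis i \notin S).
  (* [U] is the set of feet in [X] of the rungs that meet [S]. *)
  pose U := (S :&: X) :|: shift i (S :&: shift i X).
  have cU : (#|U| <= #|S|)%N.
    apply: leq_trans (leq_card_setU _ _) _; rewrite card_shift -cardsUI.
    rewrite -setIUr setIACA setIid (disjoint_setI0 dX) setI0 cards0 addn0.
    exact/subset_leq_card/subsetIl.
  have /subsetPn[z zX zU] : ~~ (X \subset U).
    apply: contraL rX => /subset_leq_card XU.
    by rewrite -leqNgt (leq_trans XU) // (leq_trans cU).
  by exists z => //; move: zU; rewrite !inE cube_addK zX !andbT negb_or.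
case/andP: zS => zS ziS.
have h1 := kconn_half r0 kX dX Sr zX zS ziS.
have dX' : [disjoint shift i X & shift i (shift i X)].
  by rewrite shiftK disjoint_sym.
have h2 : {in shift i X :\: S, forall u,
    connect (within ((X :|: shift i X) :\: S)) u z}.
  move=> u uX; apply: (@connect_trans _ _ (z + basis i)).
    have:= kconn_half r0 (kconn_shift i kX) dX' Sr _ ziS _ uX.
    by rewrite shiftK setUC; apply; rewrite ?mem_shift ?cube_addK.
  rewrite connect_withinC; apply: within_basis;
  by rewrite !inE ?zS ?ziS ?zX ?cube_addK ?zX ?orbT.
have h : {in (X :|: shift i X) :\: S, forall u,
    connect (within ((X :|: shift i X) :\: S)) u z}.
  move=> u; rewrite in_setD in_setU => /andP[uS /orP[uX|uX]].
    by apply: h1; rewrite in_setD uS.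
  by apply: h2; rewrite in_setD uS.
move=> x y xX yX; apply: connect_trans (h x xX) _.
by rewrite connect_withinC h.
Qed.

Definition subcube (P : pred V) L : {set V} := [set z : V | supp L z && P z].

Lemma subcube_cons P i L :
    (forall z, P (z + basis i) = P z) ->
  subcube P (i :: L) = subcube P L :|: shift i (subcube P L).
Proof.
move=> Pi; apply/setP=> z; rewrite !inE Pi supp_cons.
by case: (P z); rewrite ?andbT ?andbF.
Qed.

Lemma subcube_disj P i L :
  i \notin L -> [disjoint subcube P L & shift i (subcube P L)].
Proof.
move=> iL; rewrite disjoint_subset; apply/subsetP=> z; rewrite !inE.
by case/andP=> /(supp_basisN iL) /negPf->.
Qed.

Lemma kconn_subcube P r K L :
    (0 < r)%N -> uniq (K ++ L) ->
    (forall i z, i \in K -> P (z + basis i) = P z) ->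
  kconn r (subcube P L) -> kconn (size K + r)%N (subcube P (K ++ L)).
Proof.
move=> r0 + + kL; elim: K => //= i K IH /andP[iKL uKL] Pi.
rewrite subcube_cons => [|z]; last by rewrite Pi ?mem_head.
apply: kconn_double; rewrite ?addn_gt0 ?r0 ?orbT ?subcube_disj //.
by apply: IH => // j z jK; rewrite Pi // inE jK orbT.
Qed.

(** The base is a single edge, on the last letter, because [kconn_double] starts from a positive
    connectivity. *)
Lemma kconn_cube L :
  uniq L -> (0 < size L)%N -> kconn (size L) (subcube predT L).
Proof.
case/lastP: L => // L i; rewrite size_rcons -cats1 => uL _; rewrite -addn1.
apply: kconn_subcube => //.
have -> : subcube predT [:: i] = [set (0 : V); basis i].
  apply/setP=> z; rewrite !inE andbT supp_cons.
  have s0 (y : V) : supp [::] y = (y == 0).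
    apply/suppP/eqP=> [H|-> j]; last by rewrite ffunE.
    by apply/ffunP=> j; rewrite [RHS]ffunE; apply/negbTE/negP=> /H.
  by rewrite !s0 cube_add_eq add0r.
have n0 : 0 != basis i.
  by apply/eqP=> /ffunP/(_ i); rewrite basisE eqxx ffunE.
split=> [|S]; first by rewrite cards2 n0.
rewrite ltnS leqn0 cards_eq0 => /eqP-> x y; rewrite !setD0.
have h : connect (within [set (0 : V); basis i]) 0 (basis i).
  rewrite -[basis i]add0r; apply: within_basis;
  by rewrite ?add0r !inE eqxx ?orbT.
rewrite !inE => /orP[]/eqP-> /orP[]/eqP-> //.
by rewrite connect_withinC.
Qed.

End Connectivity.

(** * Connectivity of the complement of a Hamming code *)

Section HammingConnectivity.
Local Open Scope ring_scope.
Variables (I : finType) (k : nat).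
Local Notation V := {ffun I -> bool}.
Variable phi : I -> {ffun 'I_k -> bool}.
Hypothesis phi_inj : forall i j, phi i != 0 -> phi i = phi j -> i = j.
Local Notation L := (letters phi k).
Local Notation X := (subcube (fun z => syn phi z != 0) L).
Implicit Types (x y z c : V) (i j l : I) (S : {set V}).

Lemma mem_letters_full i : (i \in L) = (phi i != 0).
Proof.
rewrite mem_letters andb_idr // => _; apply/lowP=> a.
by rewrite leqNgt ltn_ord.
Qed.

Lemma uniq_letters : uniq L.
Proof. exact/filter_uniq/enum_uniq. Qed.

Lemma phiD_neq0 i j : i \in L -> i != j -> phi i + phi j != 0.
Proof.
rewrite mem_letters_full cube_add_eq add0r => i0; apply: contra => /eqP.
by move/(phi_inj i0)->.
Qed.

(* Deleting fewer than [size L - 1] vertices spares one of the [size L - 1]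
   internally disjoint paths from [c + e_i] to [c + e_j]: the one through
   [c + e_i + e_j], and those through [c + e_l] for the other letters [l]. *)
Lemma detour S c i j :
    (#|S| < (size L).-1)%N -> supp L c -> syn phi c = 0 ->
    i \in L -> j \in L -> c + basis i \notin S -> c + basis j \notin S ->
  connect (within (X :\: S)) (c + basis i) (c + basis j).
Proof.
move=> Ssize sc c0 iL jL iS jS.
have [->//|ij] := eqVneq i j.
(* [g] sends a vertex to the label of a detour it may block. Labels are the letters other than [j];
   the default [i] labels the detour through [c + basis i + basis j]. A label outside the image of
   [S] gives a free detour. *)
pose g z := odflt i [pick l | [&& l != i, l != j & (z + c) l]].
have [l [lL lj lS]] : exists l, [/\ l \in L, l != j & l \notin g @: S].
  have cL : #|[set l in L] :\ j| = (size L).-1.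
    move: (cardsD1 j [set l in L]); rewrite inE jL cardsE.
    by rewrite (card_uniqP uniq_letters) => ->.
  have /subsetPn[l] : ~~ ([set l in L] :\ j \subset g @: S).
    apply: contraL Ssize => /subset_leq_card; rewrite cL -leqNgt => cS.
    exact: leq_trans cS (leq_imset_card _ _).
  by rewrite !inE => /andP[lj lL] lS; exists l.
have nS z : g z = l -> z \notin S.
  by move=> gz; apply: contra lS => zS; rewrite -gz imset_f.
have inX z : supp L z -> syn phi z != 0 -> z \notin S -> z \in X :\: S.
  by move=> sz nz zS; rewrite !inE zS sz nz.
have one a : a \in L -> c + basis a \notin S -> c + basis a \in X :\: S.
  move=> aL; apply: inX; first by rewrite suppD // supp_basis.
  by rewrite synD syn_basis c0 add0r -mem_letters_full.
have two a b : a \in L -> b \in L -> a != b ->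
    c + basis a + basis b \notin S -> c + basis a + basis b \in X :\: S.
  move=> aL bL ab; apply: inX; first by rewrite !suppD // supp_basis.
  by rewrite !synD !syn_basis c0 add0r phiD_neq0.
have addc a b : c + basis a + basis b + c = basis a + basis b.
  by rewrite addrC !addrA cube_addvv add0r.
have [li|li] := eqVneq l i.
  have ijX : c + basis i + basis j \in X :\: S.
    apply: two => //; apply: nS; rewrite /g li.
    case: pickP => //= a /and3P[ai aj].
    by rewrite addc addvE !basisE (negPf ai) (negPf aj).
  apply: (@connect_trans _ _ (c + basis i + basis j)).
    by apply: within_basis => //; apply: one.
  rewrite addrAC connect_withinC; apply: within_basis; first exact: one.
  by rewrite addrAC.
have gl z : (forall a, a != i -> a != j -> (z + c) a = (a == l)) -> g z = l.
  move=> zE; rewrite /g; case: pickP => [a /and3P[ai aj]|/(_ l)].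
    by rewrite zE // => /eqP.
  by rewrite li lj zE // eqxx.
have lX : c + basis l \in X :\: S.
  apply: one => //; apply/nS/gl => a _ _.
  by rewrite addrAC cube_addvv add0r basisE.
have ilX : c + basis i + basis l \in X :\: S.
  apply: two => //; first by rewrite eq_sym.
  apply/nS/gl => a ai aj.
  by rewrite addc addvE !basisE (negPf ai).
have jlX : c + basis j + basis l \in X :\: S.
  apply: two => //; first by rewrite eq_sym.
  apply/nS/gl => a ai aj.
  by rewrite addc addvE !basisE (negPf aj).
apply: (@connect_trans _ _ (c + basis i + basis l)).
  by apply: within_basis => //; apply: one.
apply: (@connect_trans _ _ (c + basis l)).
  rewrite addrAC connect_withinC; apply: within_basis => //.
  by rewrite addrAC.
apply: (@connect_trans _ _ (c + basis j + basis l)).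
  rewrite addrAC; apply: within_basis => //.
  by rewrite addrAC.
by rewrite connect_withinC; apply: within_basis => //; apply: one.
Qed.

Lemma kconn_hamming : (1 < size L)%N -> kconn (size L).-1 X.
Proof.
move=> L1; split=> [|S Ssize x y].
  (* The neighbours of the codeword 0 already give [size L] vertices of [X]. *)
  have sB : @basis I @: [set l in L] \subset X.
    apply/subsetP=> _ /imsetP[l lL ->]; move: lL.
    by rewrite !inE supp_basis syn_basis -mem_letters_full => ->.
  have:= subset_leq_card sB; rewrite card_imset; last exact: basis_inj.
  rewrite cardsE (card_uniqP uniq_letters) => /(leq_trans _); apply.
  by rewrite prednK // ltnW.
have Ssize' : (#|S| < size L)%N by apply: leq_trans Ssize _; apply: leq_pred.
have [_ cQ] := kconn_cube uniq_letters (ltnW L1).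
rewrite !in_setD ![_ \in X]inE => /andP[xS /andP[sx nx]] /andP[yS /andP[sy ny]].
pose R := connect (within (X :\: S)) x.
(* Invariant along a path of the cube avoiding [S]: at a live vertex, it is reached in [X]; at a
   codeword, all its surviving neighbours are. Entering a codeword uses [detour]; leaving it uses
   the invariant. *)
pose good z := if syn phi z == 0
  then forall i, i \in L -> z + basis i \notin S -> R (z + basis i) else R z.
suff : good y by rewrite /good (negPf ny).
have good_x : good x by rewrite /good (negPf nx); apply: connect0.
have good_step z z' :
    within (subcube predT L :\: S) z z' -> good z -> good z'.
  move=> /and3P[zQ z'Q /existsP[i /eqP z'E]].
  move: zQ z'Q; rewrite !inE !andbT => /andP[zS sz] /andP[z'S sz'].
  have iL : i \in L by rewrite -supp_basis -(suppDr (basis i) sz) addrC -z'E.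
  have sE : syn phi z' = syn phi z + phi i by rewrite z'E synD syn_basis.
  have zE : z = z' + basis i by rewrite z'E cube_addK.
  rewrite /good; have [z0|nz] := eqVneq (syn phi z) 0.
    move=> /(_ i iL); rewrite -z'E => /(_ z'S).
    by rewrite sE z0 add0r (negPf (_ : phi i != 0)) // -mem_letters_full.
  have [z'0 Rz j jL jS|nz' Rz] := eqVneq (syn phi z') 0.
    apply: connect_trans Rz _; rewrite zE.
    by apply: detour => //; rewrite -zE.
  apply: connect_trans Rz _; rewrite z'E; apply: within_basis;
  by rewrite -?z'E !inE ?zS ?sz ?z'S ?sz'.
have /connectP[p pP ->] : connect (within (subcube predT L :\: S)) x y.
  by apply: cQ; rewrite // !inE ?xS ?yS ?sx ?sy.
elim: p (x) pP good_x => //= z' p IH z /andP[zz' pP] gz.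
exact/(IH z' pP)/(good_step z).
Qed.

End HammingConnectivity.

(** * Domination, size and regularity for the kernel of the syndrome *)

Section HammingCode.
Local Open Scope ring_scope.
Variables (n k : nat) (phi : 'I_n -> {ffun 'I_k -> bool}).
Hypothesis phi_onto : forall u, exists i, phi i = u.
Hypothesis phi_inj : forall i j, phi i != 0 -> phi i = phi j -> i = j.
Local Notation V := {ffun 'I_n -> bool}.
Implicit Types (x y z : V).

Lemma cube_adjE x y : cube_adj x y = step x y.
Proof.
apply/cards1P/existsP=> [[i /setP Hi]|[i /eqP->]]; exists i.
  apply/eqP/ffunP=> j; have:= Hi j; rewrite !inE addvE basisE => <-.
  by case: (x j) (y j) => -[].
by apply/setP=> j; rewrite !inE addvE basisE; case: (x j) (j == i) => -[].
Qed.

Definition code : {set hypercube n} := [set x : V | syn phi x == 0].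

Lemma nbhdE x : @nbhd (hypercube n) x = [set x + basis i | i : 'I_n].
Proof.
apply/setP=> y; rewrite inE /= cube_adjE.
by apply/existsP/imsetP=> [[i /eqP->]|[i _ ->]]; exists i.
Qed.

Lemma card_nbhd x : #|@nbhd (hypercube n) x| = n.
Proof.
rewrite nbhdE card_imset ?card_ord // => i j ij.
by apply: basis_inj; apply: (addrI x).
Qed.

Lemma code_total_perfect : total_perfect_dominating code.
Proof.
split=> [x|x]; rewrite inE => sx.
  have [i pi] := phi_onto (syn phi x).
  apply/eqP/cards1P; exists (x + basis i); apply/setP=> y.
  rewrite nbhdE !inE; apply/andP/eqP=> [[/imsetP[j _ ->]]|->].
    rewrite synD syn_basis cube_add_eq add0r => /eqP sj.
    by rewrite (@phi_inj i j) ?pi.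
  by split; [apply/imsetP; exists i | rewrite synD syn_basis pi cube_addvv].
(* Crossing a direction with zero column leads from a codeword to a codeword. *)
have [i pi] := phi_onto 0; exists (x + basis i : V).
  by rewrite inE synD syn_basis pi addr0.
by rewrite /= cube_adjE step_basis.
Qed.

(** Every fibre of the syndrome is a translate of the code, by the basis vector of a direction whose
    column is the given syndrome. *)
Lemma card_code : (2 ^ n = 2 ^ k * #|code|)%N.
Proof.
have fiber u : #|[set x : V | syn phi x == u]| = #|code|.
  have [i pi] := phi_onto u; rewrite -(card_shift i code).
  by apply: eq_card => x; rewrite !inE synD syn_basis pi cube_add_eq add0r.
have <- : #|{: V}| = (2 ^ n)%N by rewrite card_ffun card_bool card_ord.
rewrite -[LHS]sum1_card (partition_big (syn phi) predT) //=.
rewrite (eq_bigr (fun=> #|code|)) => [|u _]; last first.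
  by rewrite -(fiber u) -sum1dep_card.
by rewrite sum_nat_const card_ffun card_bool card_ord.
Qed.

Lemma code_regular : regular (delete code) (n - 1).
Proof.
move=> [x xC]; have xnC : x \notin code by rewrite -in_setC.
rewrite -(card_imset _ val_inj) /=.
have -> : val @: @nbhd (delete code) (Sub x xC) = nbhd x :\: code.
  apply/setP=> y; rewrite in_setD; apply/imsetP/andP=> [[[z zC]]|[yC xy]].
    by move=> xz ->; rewrite -in_setC; split=> //; move: xz; rewrite !inE.
  have yC' : y \in ~: code by rewrite in_setC.
  by exists (exist _ y yC'); rewrite // !inE in xy *.
by rewrite cardsD card_nbhd (proj1 code_total_perfect).
Qed.

End HammingCode.

(** * Transfer from vertex sets of the cube to induced subgraphs *)

(** A path that starts in the image of [f] never leaves it, so it pulls back edge by edge. *)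
Lemma connect_lift (T T' : finType) (f : T' -> T) (e : rel T) (e' : rel T')
    (x y : T') :
    injective f -> (forall a v, e (f a) v -> exists2 b, v = f b & e' a b) ->
  connect e (f x) (f y) -> connect e' x y.
Proof.
move=> f_inj fe /connectP[p]; elim: p x => [|v p IH] x /=.
  by move=> _ /f_inj ->; apply: connect0.
move=> /andP[/fe[b -> xb] bp] yE.
exact: connect_trans (connect1 xb) (IH b bp yE).
Qed.

Lemma card_induced (G : sgraph) (A : {set G}) : #|induced A| = #|A|.
Proof. by rewrite card_sig; apply: eq_card. Qed.

Lemma kconn_k_connected n r (D : {set hypercube n}) :
  kconn r (~: D) -> k_connected r (delete D).
Proof.
move=> [rD cD]; split=> [|S Sr]; first by rewrite card_induced.
have S'r : #|val @: S| < r by rewrite card_imset //; apply: val_inj.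
have memS (a : delete D) : (val a \in (~: D) :\: (val @: S)) = (a \notin S).
  by rewrite in_setD (valP a) andbT (mem_imset _ _ val_inj).
split=> [|x y].
  rewrite card_induced cardsCs setCK subn_gt0 card_induced.
  exact: ltn_trans Sr rD.
apply: (@connect_lift _ _ (fun a : delete S => val (val a))
  (within ((~: D) :\: (val @: S)))).
- by move=> a b /val_inj/val_inj.
- move=> a v /and3P[_ vB av].
  have vD : v \in ~: D by move: vB; rewrite in_setD => /andP[].
  have vS : exist _ v vD \in ~: S by rewrite in_setC -memS.
  exists (exist _ (exist _ v vD) vS) => //.
  by rewrite /= /induced_adj /= cube_adjE.
- have nS (a : delete S) : val a \notin S by have:= valP a; rewrite in_setC.
  by apply: (cD _ S'r); rewrite /= memS nS.
Qed.

Lemma induced_is_cycle (G : sgraph) (A : {set G}) (c : seq G) :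
    {subset c <= A} -> is_cycle c ->
  exists2 c' : seq (induced A), is_cycle c' & size c' = size c.
Proof.
move=> cA [sc /andP[cc uc]].
have [c' cE] : exists c' : seq (induced A), map val c' = c.
  elim: c cA {sc cc uc} => [|x c IH] cA; first by exists [::].
  have [y yc|c' <-] := IH; first by apply: cA; rewrite inE yc orbT.
  by exists (exist _ x (cA x (mem_head _ _)) :: c').
exists c'; last by rewrite -cE size_map.
split; first by rewrite -(size_map val) cE.
rewrite /ucycle -(map_inj_uniq val_inj) cE uc andbT.
by move: cc; rewrite -cE; case: (c') => //= x p; rewrite -map_rcons path_map.
Qed.

(** * Connectivity and cycles of the full complement, zero columns included *)

Section CodeComplement.
Local Open Scope ring_scope.
Variables (n k : nat) (phi : 'I_n -> {ffun 'I_k -> bool}).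
Hypothesis phi_onto : forall u, exists i, phi i = u.
Hypothesis phi_inj : forall i j, phi i != 0 -> phi i = phi j -> i = j.
Hypothesis k_ge2 : (2 <= k)%N.
Local Notation L := (letters phi k).
Local Notation alive := (fun z => syn phi z != 0).
Implicit Types (i j : 'I_n).

Definition zeros := [seq i <- enum 'I_n | phi i == 0].

Lemma alive_zero i z : i \in zeros -> alive (z + basis i) = alive z.
Proof.
by rewrite mem_filter => /andP[/eqP pi _]; rewrite synD syn_basis pi addr0.
Qed.

Lemma uniq_zeros_letters : uniq (zeros ++ L).
Proof.
rewrite cat_uniq uniq_letters filter_uniq ?enum_uniq //= andbT.
by apply/hasPn=> i; rewrite mem_letters_full mem_filter => /negPf->.
Qed.

Lemma mem_zeros_letters i : i \in zeros ++ L.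
Proof.
by rewrite mem_cat mem_letters_full mem_filter mem_enum andbT; case: eqP.
Qed.

Lemma size_zeros_letters : (size zeros + size L)%N = n.
Proof.
rewrite -size_cat -(card_uniqP uniq_zeros_letters) -[RHS]card_ord.
by apply: eq_card => i; rewrite mem_zeros_letters.
Qed.

Lemma code_compl : ~: code phi = subcube alive (zeros ++ L).
Proof.
apply/setP=> z; rewrite !inE; suff -> : supp (zeros ++ L) z by [].
by apply/suppP=> i _; apply: mem_zeros_letters.
Qed.

(** Two distinct unit vectors occur as columns. This makes the base value [(size L).-1] positive, as
    [kconn_subcube] requires. *)
Lemma letters_gt1 : (1 < size L)%N.
Proof.
have [i pi] := phi_onto (basis (Ordinal k_ge2)).
have [j pj] := phi_onto (basis (Ordinal (ltnW k_ge2))).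
have b0 (a : 'I_k) : basis a != 0.
  by apply/eqP=> /ffunP/(_ a); rewrite basisE eqxx ffunE.
have ij : i != j.
  by apply/eqP=> ij; move: pi; rewrite ij pj => /basis_inj [].
apply: (@uniq_leq_size _ [:: i; j]); first by rewrite /= inE ij.
by move=> l; rewrite !inE mem_letters_full => /orP[]/eqP->; rewrite ?pi ?pj b0.
Qed.

Lemma code_connected : k_connected (n - 1) (delete (code phi)).
Proof.
apply: kconn_k_connected; rewrite code_compl.
have -> : (n - 1 = size zeros + (size L).-1)%N.
  have := size_zeros_letters; rewrite -{1}(prednK (ltnW letters_gt1)) addnS.
  by rewrite subn1 => /(congr1 predn)/= <-.
apply: kconn_subcube.
- by rewrite -subn1 subn_gt0 letters_gt1.
- exact: uniq_zeros_letters.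
- by move=> i z; apply: alive_zero.
- exact: kconn_hamming letters_gt1.
Qed.

Lemma code_bipancyclic : bipancyclic (delete (code phi)).
Proof.
have k_gt0 := ltnW k_ge2.
have [x [w h]] : exists x w, ham (live phi k) x w.
  by apply: exists_ham_live => //; rewrite k_gt0 leqnn.
have [i0 pi0] := phi_onto 0.
have i0z : i0 \in zeros by rewrite mem_filter pi0 eqxx mem_enum.
(* One zero direction [i0] is reserved for the rungs of the ladder; the others, [K], are absorbed
   into the Hamiltonian path of one side. *)
have [K zE] : exists K, perm_eq zeros (i0 :: K).
  by exists (rem i0 zeros); apply: perm_to_rem.
have pz : perm_eq (zeros ++ L) (i0 :: K ++ L) by rewrite -cat_cons perm_cat2r.
move: uniq_zeros_letters; rewrite (perm_uniq pz) /= => /andP[i0n uKL].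
have Kz i z : i \in K -> alive (z + basis i) = alive z.
  by move=> iK; rewrite alive_zero // (perm_mem zE) inE iK orbT.
have [w1 h1] := ham_supp_cat uKL Kz h.
set X := (fun z => _) in h1.
have dX z : X z -> ~~ X (z + basis i0).
  by case/andP=> sz _; rewrite /X (negPf (supp_basisN i0n sz)).
have XE z : X z || X (z + basis i0) = (z \in ~: code phi).
  rewrite code_compl /X alive_zero // -andb_orl -supp_cons inE.
  by congr (_ && _); apply/eq_supp => i; rewrite (perm_mem pz).
have cardE : #|delete (code phi)| = (size w1).+1.*2.
  have [u m] := ham_double h1 dX.
  rewrite card_induced.
  have -> : #|~: code phi| = #|walk x (w1 ++ i0 :: rev w1)|.
    by apply: eq_card => z; rewrite -XE m.
  by rewrite (card_uniqP u) size_walk size_cat /= size_rev addnS doubleS addnn.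
move=> l; rewrite cardE => l_even /andP[l_ge4 l_le].
(* A ladder with [r.+1] rungs gives length 2(r + 1), so [r] is [l./2.-1]. *)
have lE : l = (l./2.-1.+1).*2.
  rewrite prednK; last by rewrite half_gt0 (leq_trans _ l_ge4).
  by rewrite -[LHS]odd_double_half (negPf l_even).
have rw : (l./2.-1 <= size w1)%N.
  by move: l_le; rewrite {1}lE leq_double.
have [] := ladder_cycle h1 dX rw; set c := walk _ _ => cc sc cX.
have cA : {subset c <= ~: code phi} by move=> z /cX; rewrite XE.
have cyc : @is_cycle (hypercube n) c.
  split; first by rewrite sc -lE (leq_trans _ l_ge4).
  case/andP: cc => cc uc; rewrite /ucycle uc andbT.
  by rewrite -(eq_cycle (@cube_adjE n)) in cc.
have [c' cyc' sc'] := @induced_is_cycle (hypercube n) _ c cA cyc.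
by exists c'; rewrite // sc' sc -lE.
Qed.

End CodeComplement.

(** * Choice of the columns and conclusion *)

Lemma exists_columns n k : (2 ^ k <= n)%N ->
  exists phi : 'I_n -> {ffun 'I_k -> bool},
    (forall u, exists i, phi i = u) /\
    (forall i j, phi i != 0%R -> phi i = phi j -> i = j).
Proof.
move=> kn; pose W := {ffun 'I_k -> bool}.
have cW : #|W| = (2 ^ k)%N by rewrite card_ffun card_bool card_ord.
rewrite -cW in kn.
(* List all vectors once; the default 0 of [nth] fills the remaining directions with zero
   columns. *)
pose phi (i : 'I_n) : W := nth 0%R (enum W) i.
exists phi; split=> [u|i j].
  have ui : (index u (enum W) < n)%N.
    by apply: leq_trans kn; rewrite cardE index_mem mem_enum.
  by exists (Ordinal ui); rewrite /phi /= nth_index // mem_enum.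
have lt l : phi l != 0%R -> (l < size (enum W))%N.
  by rewrite ltnNge; apply: contra => ?; rewrite /phi nth_default.
move=> i0 ij; apply/val_inj/eqP.
by rewrite -(nth_uniq 0%R (lt i i0) _ (enum_uniq W)) ?lt -?ij //; apply/eqP.
Qed.

Theorem theorem6p5 (n k : nat) (hn : 4 <= n) (hk : 2 <= k)
    (hnk : 2 ^ k - 1 < n < 2 ^ k.+1 - 1) :
  exists D : {set hypercube n},
    [/\ total_perfect_dominating D,
        #|D| = 2 ^ (n - k),
        regular (delete D) (n - 1),
        k_connected (n - 1) (delete D)
      & bipancyclic (delete D)].
Proof.
have kn : 2 ^ k <= n by case/andP: hnk; rewrite subn1 prednK ?expn_gt0.
have [phi [onto inj]] := exists_columns kn.
exists (code phi); split.
- exact: code_total_perfect.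
- apply/eqP; rewrite -(eqn_pmul2l (_ : 0 < 2 ^ k)) ?expn_gt0 //.
  (* The exponent [n - k] is a true difference, since k < 2^k <= n. *)
  rewrite -card_code // -expnD subnKC //.
  exact: leq_trans (ltnW (ltn_expl k _)) kn.
- exact: code_regular.
- exact: code_connected.
- exact: code_bipancyclic.
Qed.
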